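(* Let $X$ be a real uniformly convex and uniformly smooth Banach space with dual $X^*$ and let $r>0$. The Mordukhovich derivative $\widehat{D}^*P_{r\mathbb{B}}$ of the metric projection $P_{r\mathbb{B}}\colon X\to r\mathbb{B}$ onto the closed ball of radius $r$ centered at the origin has the following properties. (i) For every $\bar{x}\in r\mathbb{B}^o$, $\widehat{D}^*P_{r\mathbb{B}}(\bar{x})(y^* )=\{y^*\}$ for every $y^*\in X^*$. (ii) For every $\bar{x}\in X\setminus r\mathbb{B}$, $$\widehat{D}^*P_{r\mathbb{B}}(\bar{x})(y^* )=\left\{\frac{r}{\|\bar{x}\|}\left(y^*-\frac{\langle y^*,\bar{x}\rangle}{\|\bar{x}\|^2}J(\bar{x})\right)\right\}\quad\text{for every } y^*\in X^*.$$ In particular, (a) $\widehat{D}^*P_{r\mathbb{B}}(\bar{x})(y^* )=\left\{\frac{r}{\|\bar{x}\|}y^*\right\}$ if $y^*\perp\bar{x}$ (i.e. $\langle y^*,\bar{x}\rangle=0$); (b) $\widehat{D}^*P_{r\mathbb{B}}(\bar{x})(J(\bar{x}))=\{\theta^*\}$. (iii) If $\bar{x}\in r\mathbb{S}$, write $\bar{x}^*=J(\bar{x})$. Then: (a) $\widehat{D}^*P_{r\mathbb{B}}(\bar{x})(\theta^* )=\{\theta^*\}$; (b) for any $y^*\in X^*\setminus\{\theta^*\}$: Part 1. If $\theta^*\in\widehat{D}^*P_{r\mathbb{B}}(\bar{x})(y^* )$, then $$\langle y^*,\bar{x}\rangle\le 0,\qquad -J^*(o^*(y^* ))\notin\bar{x}_r^{\uparrow},\qquad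 \frac{\langle y^*,\bar{x}\rangle}{r^2}\langle\bar{x}^*,J^*(o^*(y^* ))\rangle+\|J^*(o^*(y^* ))\|^2\le 0.$$ Part 2. If $o^*(y^* )=\theta^*$ and $\langle y^*,\bar{x}\rangle<0$, then $\theta^*\in\widehat{D}^*P_{r\mathbb{B}}(\bar{x})(y^* )$. In particular, $\theta^*\in\widehat{D}^*P_{r\mathbb{B}}(\bar{x})(-J(\bar{x}))$; (c) $\widehat{D}^*P_{r\mathbb{B}}(\bar{x})(J(\bar{x}))=\emptyset$.
   Context: $(X,\|\cdot\|)$ is a real uniformly convex and uniformly smooth Banach space with dual $(X^*,\|\cdot\|_* )$ and pairing $\langle\cdot,\cdot\rangle$ between $X^*$ and $X$; $\theta,\theta^*$ are the origins of $X,X^*$. $\mathbb{B}$ is the closed unit ball and $\mathbb{S}$ the unit sphere of $X$; $r\mathbb{B}$, $r\mathbb{S}$ are the closed ball and sphere of radius $r$ centered at $\theta$, and $r\mathbb{B}^o$ is the interior of $r\mathbb{B}$. $J\colon X\to X^*$ and $J^*\colon X^*\to X$ are the normalized duality mappings, characterized by $\langle J(x),x\rangle=\|x\|^2=\|J(x)\|_*^2$ for $x\in X$ and $\langle x^*,J^*(x^* )\rangle=\|x^*\|_*^2=\|J^*(x^* )\|^2$ for $x^*\in X^*$ (single valued in this setting). For a nonempty closed convex $C\subseteq X$, the metric projection $P_C\colon X\to C$ sends $x$ to the unique $P_C(x)\in C$ with $\|x-P_C(x)\|\le\|x-z\|$ for all $z\in C$. The Mordukhovich derivative (Fréchet coderivative)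 of $P_C$ at $\bar{x}\in X$ is the set-valued map $\widehat{D}^*P_C(\bar{x})\colon X^*\rightrightarrows X^*$ given for $y^*\in X^*$ by $$\widehat{D}^*P_C(\bar{x})(y^* )=\left\{x^*\in X^*:\limsup_{u\to\bar{x}}\frac{\langle x^*,u-\bar{x}\rangle-\langle y^*,P_C(u)-P_C(\bar{x})\rangle}{\|u-\bar{x}\|+\|P_C(u)-P_C(\bar{x})\|}\le 0\right\}.$$ For $\bar{x}\in X\setminus\{\theta\}$ with $\bar{x}^*=J(\bar{x})$, the map $o^*\colon X^*\to X^*$ (depending on $\bar{x}$) is $o^*(x^* )=x^*-\frac{\langle x^*,\bar{x}\rangle}{\|\bar{x}\|^2}\bar{x}^*$. For $x\in r\mathbb{S}$: $x_r^{\uparrow}=\{v\in X\setminus\{\theta\}:\text{there is }\delta>0\text{ such that }\|x+tv\|>r\text{ for all }t\in(0,\delta)\}$. *)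

(* Defs.v *)
From HB Require Import structures.
From mathcomp Require Import all_boot all_order all_algebra.
From mathcomp Require Import all_classical all_reals all_analysis.

Set Implicit Arguments.
Unset Strict Implicit.
Unset Printing Implicit Defensive.

Import Order.TTheory GRing.Theory Num.Theory.
Import numFieldNormedType.Exports.

Local Open Scope classical_set_scope.
Local Open Scope ring_scope.

Section TopologicalDual.
Variables (R : realType) (X : normedModType R).

Definition linear_continuous_pred : {pred X -> R^o} :=
  fun f => `[< linear f /\ continuous f >].

(* [R^o] is [R] as a module over itself; a dual element applied to a vector
   is the pairing of the two. *)
Record topdual := TopDual {
  topdual_val :> X -> R^o;
  topdualP : topdual_val \in linear_continuous_pred }.

HB.instance Definition _ := [isSub of topdual for topdual_val].
HB.instance Definition _ := [Choice of topdual by <:].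

Lemma linear_continuous_submod_closed : submod_closed linear_continuous_pred.
Proof.
split=> [|a f g /asboolP[lf cf] /asboolP[lg cg]]; apply/asboolP; split.
- by move=> a x y; rewrite /= scaler0 addr0.
- by move=> x; exact: cvg_cst.
- move=> b x y; rewrite !fctE lf lg !scalerDr !scalerA (mulrC a b).
  by rewrite addrACA.
- move=> x; apply: cvgD; last exact: cg.
  by apply: cvgZl_tmp; exact: cf.
Qed.

HB.instance Definition _ := GRing.isSubmodClosed.Build R (X -> R^o)
  linear_continuous_pred linear_continuous_submod_closed.
HB.instance Definition _ := [SubChoice_isSubLmodule of topdual by <:].

Lemma topdual_is_linear (f : topdual) : linear f.
Proof. by have /asboolP[] := topdualP f. Qed.

HB.instance Definition _ (f : topdual) :=
  GRing.isLinear.Build R X R^o _ (topdual_val f) (topdual_is_linear f).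

Lemma topdual_continuous (f : topdual) : continuous f.
Proof. by have /asboolP[] := topdualP f. Qed.

Definition dual_norm (f : topdual) : R :=
  sup [set `|f x| | x in [set x : X | `|x| <= 1]].

Lemma dual_norm_has_ubound (f : topdual) :
  has_ubound [set `|f x| | x in [set x : X | `|x| <= 1]].
Proof.
have /(continuous_linear_bounded 0)/linear_boundedP := @topdual_continuous f 0.
move=> /pinfty_ex_gt0[M M0 fM]; exists M => _ [x /= x1 <-].
by rewrite (le_trans (fM x))// ler_piMr// ltW.
Qed.

Lemma dual_norm_ub (f : topdual) (x : X) : `|x| <= 1 -> `|f x| <= dual_norm f.
Proof.
by move=> x1; apply: ub_le_sup; [exact: dual_norm_has_ubound|exists x].
Qed.

Lemma dual_norm_le (f : topdual) (M : R) :
  (forall x : X, `|x| <= 1 -> `|f x| <= M) -> dual_norm f <= M.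
Proof.
move=> fM; apply: ge_sup; last by move=> _ [x /= x1 <-]; exact: fM.
by exists `|f 0|; exists 0 => //=; rewrite normr0.
Qed.

Lemma dual_normD (f g : topdual) :
  dual_norm (f + g) <= dual_norm f + dual_norm g.
Proof.
apply: dual_norm_le => x x1.
by rewrite (le_trans (ler_normD _ _))// lerD// dual_norm_ub.
Qed.

Lemma dual_normZ (a : R) (f : topdual) :
  dual_norm (a *: f) = `|a| * dual_norm f.
Proof.
have le b (h : topdual) : dual_norm (b *: h) <= `|b| * dual_norm h.
  apply: dual_norm_le => x x1; rewrite [X in X <= _]normrM.
  by rewrite ler_wpM2l// dual_norm_ub.
apply/eqP; rewrite eq_le le/=; have [->|a0] := eqVneq a 0.
  rewrite normr0 mul0r; apply: le_trans (dual_norm_ub _ (x := 0) _) => //.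
  by rewrite normr0.
rewrite -ler_pdivlMl ?normr_gt0// -normfV (le_trans _ (le _ _))//.
by rewrite scalerA mulVf// scale1r.
Qed.

Lemma dual_norm0_eq0 (f : topdual) : dual_norm f = 0 -> f = 0.
Proof.
move=> f0; apply/val_inj/funext => x /=.
have [->|x0] := eqVneq x 0; first exact: linear0.
have := @dual_norm_ub f (`|x|^-1 *: x).
rewrite normrZ normfV normr_id mulVf ?normr_eq0// lexx f0 => /(_ isT).
rewrite linearZ/= normrM normfV normr_id => h.
apply/eqP; rewrite -normr_le0; move: h.
by rewrite pmulr_rle0// invr_gt0 normr_gt0.
Qed.

HB.instance Definition _ := Lmodule_isNormed.Build R topdual
  dual_normD dual_normZ dual_norm0_eq0.

End TopologicalDual.

Section Definitions.
Variables (R : realType) (X : normedModType R).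

Definition uniformly_convex := forall e : R, 0 < e ->
  exists2 d : R, 0 < d & forall x y : X, `|x| = 1 -> `|y| = 1 ->
    e <= `|x - y| -> `|2^-1 *: (x + y)| <= 1 - d.

(* Equivalent to rho(t) / t --> 0 as t --> 0+ for the modulus of smoothness
   rho(t) = sup {(|x + t y| + |x - t y|) / 2 - 1 : |x| = |y| = 1}. *)
Definition uniformly_smooth := forall e : R, 0 < e ->
  exists2 d : R, 0 < d & forall x y : X, `|x| = 1 -> `|y| <= d ->
    `|x + y| + `|x - y| <= 2 + e * `|y|.

(* In a uniformly convex and uniformly smooth Banach space the sets under [xget]
   in the next three definitions are singletons (for [metric_projection], when
   [C] is nonempty, closed and convex), and the default value 0 is not used. *)
Definition duality_map (x : X) : topdual X :=
  xget 0 [set f : topdual X | f x = `|x| ^+ 2 /\ `|x| ^+ 2 = `|f| ^+ 2].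

Definition dual_duality_map (f : topdual X) : X :=
  xget 0 [set x : X | f x = `|f| ^+ 2 /\ `|f| ^+ 2 = `|x| ^+ 2].

Definition metric_projection (C : set X) (x : X) : X :=
  xget 0 [set p : X | C p /\ forall z, C z -> `|x - p| <= `|x - z|].

Definition mordukhovich_derivative (F : X -> X) (x : X) (ys : topdual X) :
    set (topdual X) :=
  [set xs : topdual X |
    (limf_esup
      (fun u : X => ((xs (u - x) - ys (F u - F x)) /
                     (`|u - x| + `|F u - F x|))%:E)
      x^' <= 0)%E].

Definition ostar (x : X) (f : topdual X) : topdual X :=
  f - (f x / `|x| ^+ 2) *: duality_map x.

Definition up_directions (r : R) (x : X) : set X :=
  [set v : X | v <> 0 /\
    exists2 d : R, 0 < d & forall t : R, 0 < t < d -> r < `|x + t *: v|].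

End Definitions.

(* Main.v *)
From HB Require Import structures.
Require Import Defs.
From mathcomp Require Import all_boot all_order all_algebra.
From mathcomp Require Import all_classical all_reals all_analysis.
From mathcomp Require Import ring lra.

(** Uniform smoothness makes the norm Fréchet differentiable away from the
    origin, with derivative [J x / |x|] at [x]; the existence of [J x] itself
    comes from the fact that the directional derivative of the norm is then
    linear, without Hahn-Banach. By strict convexity the projection onto the
    ball of radius [r] is the identity inside and [u |-> (r / |u|) u] outside,
    so it is 2-Lipschitz, and away from the sphere it has an explicit Fréchet
    derivative; the coderivative is then the singleton of the transposed
    derivative. On the sphere, testing the defining inequality along
    [h = t v] with [t -> 0+], inside or outside the ball, gives each necessary
    condition, while [J x (P u) <= |x| |P u| <= r^2 = J x (P x)] shows that
    [0] is in the coderivative at [- c (J x)] for [c >= 0]. *)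

Set Implicit Arguments.
Unset Strict Implicit.
Unset Printing Implicit Defensive.

Import Order.TTheory GRing.Theory Num.Theory.
Import numFieldNormedType.Exports.

Local Open Scope classical_set_scope.
Local Open Scope ring_scope.

(** * Dual norm bounds and the epsilon-delta form of the coderivative *)

Lemma topdualZ (R : realType) (X : normedModType R) (f : topdual X) (a : R)
    (x : X) :
  f (a *: x) = a * f x :> R.
Proof. exact: linearZ. Qed.

Lemma topdual_norm_le (R : realType) (X : normedModType R) (f : topdual X)
    (x : X) :
  `|f x| <= `|f| * `|x|.
Proof.
have [->|x0] := eqVneq x 0; first by rewrite linear0 !normr0 mulr0.
have nx0 : 0 < `|x| by rewrite normr_gt0.
have := @dual_norm_ub R X f (`|x|^-1 *: x).
rewrite normrZ normfV normr_id mulVf ?gt_eqF// lexx => /(_ isT).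
by rewrite linearZ/= normrM normfV normr_id ler_pdivrMl// mulrC.
Qed.

Lemma topdual_le (R : realType) (X : normedModType R) (f : topdual X)
    (x : X) :
  f x <= `|f| * `|x| :> R.
Proof. exact: le_trans (ler_norm _) (topdual_norm_le f x). Qed.

Lemma topdual_norm_bound (R : realType) (X : normedModType R) (f : topdual X)
    (M : R) :
  (forall v, `|f v| <= M * `|v|) -> 0 <= M -> `|f| <= M.
Proof.
move=> fM M0; apply: dual_norm_le => v v1.
by rewrite (le_trans (fM v))// ler_piMr.
Qed.

Lemma topdual_eq_of_le (R : realType) (X : normedModType R) (f g : topdual X) :
  (forall v, f v <= g v :> R) -> f = g.
Proof.
move=> fg; apply/val_inj/funext => v /=.
have /= := fg (- v); rewrite !linearN lerN2 => gf.
by apply/eqP; rewrite eq_le fg.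
Qed.

Lemma le0_of_le_eps_mul (R : realType) (a b : R) :
  0 <= b -> (forall e, 0 < e -> a <= e * b) -> a <= 0.
Proof.
move=> b0 ab; rewrite leNgt; apply/negP => a0.
have b1 : 0 < 2 * (b + 1) by lra.
have := ab (a / (2 * (b + 1))) (divr_gt0 a0 b1).
have -> : a / (2 * (b + 1)) * b = (a * b) / (2 * (b + 1)) by field; lra.
by rewrite ler_pdivlMr//; nra.
Qed.

Lemma exists_small_scaling (R : realType) (X : normedModType R) (v : X)
    (d : R) : 0 < d ->
  exists2 t : R, 0 < t < d & `|t *: v| < d.
Proof.
move=> d0; have v1 : 0 < `|v| + 2 by rewrite ltr_wpDl.
have t0 : 0 < d / (`|v| + 2) by rewrite divr_gt0.
(* Adding 2 rather than 1 keeps [t < d] strict even when [v = 0]. *)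
exists (d / (`|v| + 2)).
  by rewrite t0 ltr_pdivrMr// ltr_pMr//; have := normr_ge0 v; lra.
rewrite normrZ gtr0_norm// mulrAC ltr_pdivrMr// ltr_pM2l//; lra.
Qed.

(** For [h != 0] the denominator is positive and can be cleared; at [h = 0] both sides vanish, so
    the punctured neighborhood may be replaced by a full ball. *)
Lemma mordukhovichP (R : realType) (X : normedModType R) (F : X -> X) (x : X)
    (ys xs : topdual X) :
  mordukhovich_derivative F x ys xs <->
  forall e : R, 0 < e -> exists2 d : R, 0 < d & forall h : X, `|h| < d ->
    xs h - ys (F (x + h) - F x) <= e * (`|h| + `|F (x + h) - F x|) :> R.
Proof.
split=> [/= D e e0|D].
  have : (limf_esup (fun u : X => ((xs (u - x) - ys (F u - F x)) /
      (`|u - x| + `|F u - F x|))%:E) x^' < e%:E)%E.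
    by rewrite (le_lt_trans D)// lte_fin.
  move=> /ereal_inf_lt[_ [V /= + <-] supV].
  rewrite /dnbhs /within /= => /nbhs_normP[d /= d0 dV].
  exists d => // h hd; have [->|h0] := eqVneq h 0.
    by rewrite addr0 subrr !linear0 !normr0 addr0 mulr0.
  have Vh : V (x + h).
    apply: dV; first by rewrite /= opprD addNKr normrN.
    by rewrite -subr_eq0 addrC addKr.
  have : (((xs (x + h - x) - ys (F (x + h) - F x)) /
      (`|x + h - x| + `|F (x + h) - F x|))%:E <= e%:E)%E.
    apply/ltW; apply: le_lt_trans supV.
    by apply: ereal_sup_ubound; exists (x + h).
  by rewrite lee_fin (addrC x h) addrK ler_pdivrMr// ltr_wpDr// normr_gt0.
apply/lee_addgt0Pr => e e0; rewrite add0e.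
have [d d0 dD] := D e e0.
apply: ge_ereal_inf; exists (ereal_sup [set ((xs (u - x) - ys (F u - F x)) /
     (`|u - x| + `|F u - F x|))%:E | u in [set u | `|u - x| < d /\ u != x]]).
  exists [set u | `|u - x| < d /\ u != x] => //=.
  rewrite /dnbhs /within /=; apply/nbhs_normP; exists d => //= u /= ud ux.
  by rewrite distrC.
apply: ge_ereal_sup => _ [u [/= ud ux] <-]; rewrite lee_fin.
rewrite ler_pdivrMr; last by rewrite ltr_wpDr// normr_gt0 subr_eq0.
by have := dD _ ud; rewrite subrKC.
Qed.

Lemma mordukhovich_zeroP (R : realType) (X : normedModType R) (F : X -> X)
    (x : X) (ys : topdual X) :
  mordukhovich_derivative F x ys 0 <->
  forall e : R, 0 < e -> exists2 d : R, 0 < d & forall h : X, `|h| < d ->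
    - ys (F (x + h) - F x) <= e * (`|h| + `|F (x + h) - F x|) :> R.
Proof.
have E h (a : R) : (0 : topdual X) h - a = - a by exact: sub0r.
by rewrite mordukhovichP; split=> D e /D[d d0 dP]; exists d => // h /dP;
  rewrite E.
Qed.

(** Testing at [t v] and dividing by [t] gives [zs v <= xs v] for all [v], hence equality by
    linearity. The Lipschitz bound keeps the displacement of [F] of order [t]. Differentiability is
    asked of [ys] composed with [F] only, not of [F]. *)
Lemma coderivative_singleton (R : realType) (X : normedModType R) (F : X -> X)
    (x : X) (ys xs : topdual X) (C : R) :
  (forall h, `|F (x + h) - F x| <= C * `|h|) ->
  (forall e : R, 0 < e -> exists2 d : R, 0 < d & forall h : X, `|h| < d ->
    `|ys (F (x + h) - F x) - xs h| <= e * `|h|) ->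
  mordukhovich_derivative F x ys = [set xs].
Proof.
move=> FC Fxs; apply/seteqP; split=> [zs /mordukhovichP D|_ ->].
  apply: topdual_eq_of_le => v; rewrite -subr_le0.
  have C0 : 0 <= C * `|v| by exact: le_trans (FC v).
  apply: (@le0_of_le_eps_mul _ _ (C * `|v| + 2 * `|v|)).
    by rewrite addr_ge0 // mulr_ge0.
  move=> e e0.
  have [d1 d10 D1] := D _ e0; have [d2 d20 D2] := Fxs _ e0.
  have d0 : 0 < Num.min d1 d2 by rewrite lt_min d10.
  have [t /andP[t0 _]] := exists_small_scaling v d0.
  rewrite lt_min => /andP[t1 t2].
  have := D1 _ t1; have := D2 _ t2; have := FC (t *: v).
  rewrite !linearZ/= normrZ (gtr0_norm t0) ler_norml => FCt /andP[_ h2] h1.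
  rewrite -(ler_pM2l t0).
  rewrite /GRing.scale/= in h1 h2.
  move: h1 h2 FCt; move: (ys _) (zs v) (xs v) => a b c.
  move: `|F _ - _| => N h1 h2 h3.
  have : e * N <= e * (C * (t * `|v|)) by rewrite ler_pM2l.
  rewrite /= in h1 h2 *. lra.
apply/mordukhovichP => e e0; have [d d0 Fd] := Fxs e e0.
exists d => // h /Fd; rewrite ler_norml => /andP[h1 _].
have : 0 <= e * `|F (x + h) - F x| by rewrite mulr_ge0// ltW.
move: h1; move: (ys _) (xs h) => a b. lra.
Qed.

(** * The duality map as a derivative of the norm *)

Section DirectionalDerivativeOfNorm.
Variables (R : realType) (X : normedModType R).
Implicit Types (x y z : X) (t : R).

Definition norm_quotient x y t : R := (`|x + t *: y| - `|x|) / t.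

(** By convexity of the norm the quotient is nondecreasing in [t], so this infimum is the one-sided
    directional derivative of the norm at [x] along [y]. *)
Definition norm_derivative x y : R :=
  inf [set norm_quotient x y t | t in [set t | 0 < t]].

Lemma norm_quotient_ge x y t : 0 < t -> - `|y| <= norm_quotient x y t.
Proof.
move=> t0; rewrite ler_pdivlMr// lerBrDr.
have := ler_normB (x + t *: y) (t *: y).
rewrite addrK normrZ (gtr0_norm t0) => h; lra.
Qed.

Lemma norm_quotient_le x y t : 0 < t -> norm_quotient x y t <= `|y|.
Proof.
move=> t0; rewrite ler_pdivrMr//.
have := ler_normD x (t *: y); rewrite normrZ (gtr0_norm t0) => h; lra.
Qed.

Lemma norm_derivative_le x y t :
  0 < t -> norm_derivative x y <= norm_quotient x y t.
Proof.
move=> t0; apply: ge_inf; last by exists t.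
by exists (- `|y|) => _ [s s0 <-]; exact: norm_quotient_ge.
Qed.

Lemma norm_derivative_ge x y M :
  (forall t, 0 < t -> M <= norm_quotient x y t) -> M <= norm_derivative x y.
Proof.
move=> Mq; apply: lb_le_inf; last by move=> _ [t t0 <-]; exact: Mq.
by exists (norm_quotient x y 1); exists 1 => //=.
Qed.

Lemma norm_derivative_norm x y : `|norm_derivative x y| <= `|y|.
Proof.
rewrite ler_norml norm_derivative_ge/=; last exact: norm_quotient_ge.
exact: le_trans (norm_derivative_le x y ltr01) (norm_quotient_le x y ltr01).
Qed.

Lemma norm_derivative0 x : norm_derivative x 0 = 0.
Proof.
by apply/eqP; rewrite -normr_le0 (le_trans (norm_derivative_norm x 0))// normr0.
Qed.

Lemma norm_derivative_self x : norm_derivative x x = `|x|.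
Proof.
apply/eqP; rewrite eq_le.
rewrite (le_trans (norm_derivative_le x x ltr01)) ?norm_quotient_le//=.
apply: norm_derivative_ge => t t0; rewrite ler_pdivlMr//.
have -> : x + t *: x = (1 + t) *: x by rewrite scalerDl scale1r.
by rewrite normrZ gtr0_norm ?addr_gt0//; lra.
Qed.

(* With [u = s t / (s + t)] the point [x + u (y + z)] is the convex combination
   of [x + s y] and [x + t z] with weights [t / (s + t)] and [s / (s + t)]. *)
Lemma norm_quotientD x y z s t : 0 < s -> 0 < t ->
  norm_quotient x (y + z) (s * t / (s + t)) <=
  norm_quotient x y s + norm_quotient x z t.
Proof.
move=> s0 t0; have st0 : 0 < s + t by exact: addr_gt0.
have u0 : 0 < s * t / (s + t) by rewrite divr_gt0// mulr_gt0.
rewrite ler_pdivrMr//.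
have -> : x + (s * t / (s + t)) *: (y + z) =
    (t / (s + t)) *: (x + s *: y) + (s / (s + t)) *: (x + t *: z).
  rewrite !scalerDr !scalerA addrACA -scalerDl -mulrDl (addrC t s).
  rewrite divff ?gt_eqF// scale1r.
  have -> : t / (s + t) * s = s * t / (s + t) by ring.
  by have -> : s / (s + t) * t = s * t / (s + t) by ring.
have := ler_normD ((t / (s + t)) *: (x + s *: y))
  ((s / (s + t)) *: (x + t *: z)).
rewrite (normrZ (t / _)) (normrZ (s / _)).
rewrite (gtr0_norm (divr_gt0 t0 st0)) (gtr0_norm (divr_gt0 s0 st0)).
rewrite /norm_quotient; move: `|_ + s *: _| `|_ + t *: _| => a b h.
have -> : ((a - `|x|) / s + (b - `|x|) / t) * (s * t / (s + t)) =
  t / (s + t) * a + s / (s + t) * b - `|x|.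
  by field; rewrite !gt_eqF.
by rewrite lerD2r.
Qed.

(** The steps [s] and [t] are independent, so the two infima on the right can be taken one after the
    other. *)
Lemma norm_derivativeD x y z :
  norm_derivative x (y + z) <= norm_derivative x y + norm_derivative x z.
Proof.
rewrite -lerBlDr; apply: norm_derivative_ge => s s0.
rewrite lerBlDr -lerBlDl; apply: norm_derivative_ge => t t0; rewrite lerBlDl.
apply: le_trans (norm_quotientD x y z s0 t0).
by rewrite norm_derivative_le// divr_gt0 ?mulr_gt0// addr_gt0.
Qed.

Lemma norm_derivativeZ x y a : 0 < a ->
  norm_derivative x (a *: y) = a * norm_derivative x y.
Proof.
have ge b z : 0 < b -> b * norm_derivative x z <= norm_derivative x (b *: z).
  move=> b0; apply: norm_derivative_ge => t t0.
  have -> : norm_quotient x (b *: z) t = b * norm_quotient x z (t * b).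
    by rewrite /norm_quotient scalerA; field; rewrite !gt_eqF.
  by rewrite ler_pM2l// norm_derivative_le// mulr_gt0.
move=> a0; apply/eqP; rewrite eq_le ge// andbT -ler_pdivrMl//.
have := ge a^-1 (a *: y); rewrite invr_gt0 a0 => /(_ isT).
by rewrite scalerA mulVf ?gt_eqF// scale1r.
Qed.

Hypothesis hsmooth : uniformly_smooth X.

Lemma norm_smooth x (e : R) : x != 0 -> 0 < e ->
  exists2 d : R, 0 < d & forall y, `|y| <= d ->
    `|x + y| + `|x - y| <= 2 * `|x| + e * `|y|.
Proof.
move=> x0 e0; have nx : 0 < `|x| by rewrite normr_gt0.
have [d d0 dP] := hsmooth e0.
exists (d * `|x|); first exact: mulr_gt0.
move=> y yd; have := dP (`|x|^-1 *: x) (`|x|^-1 *: y).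
rewrite -scalerDr -scalerBr !normrZ !normfV !normr_id mulVf ?gt_eqF//.
rewrite (ler_pdivrMl _ _ nx) mulrC => /(_ erefl yd).
rewrite -mulrDr ler_pdivrMl// => /le_trans; apply.
by rewrite mulrDr (mulrC _ 2) (mulrCA _ e) mulVKf ?gt_eqF.
Qed.

(** Subadditivity gives one inequality. For the other, the quotients along [y] and [- y] sum to
    [(|x + t y| + |x - t y| - 2 |x|) / t], which smoothness bounds by [e |y|]. *)
Lemma norm_derivativeN x y : x != 0 ->
  norm_derivative x (- y) = - norm_derivative x y.
Proof.
move=> x0; apply/eqP; rewrite eq_le; apply/andP; split; last first.
  rewrite -subr_ge0 opprK addrC.
  by rewrite (le_trans _ (norm_derivativeD _ _ _))// subrr norm_derivative0.
rewrite -subr_le0 opprK.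
apply: (le0_of_le_eps_mul (normr_ge0 y)) => e e0.
have [d d0 dP] := norm_smooth x0 e0.
have y1 : 0 < `|y| + 1 by rewrite ltr_wpDl.
pose t := d / (`|y| + 1); have t0 : 0 < t by exact: divr_gt0.
have ty : `|t *: y| <= d.
  by rewrite normrZ gtr0_norm// mulrAC ler_pdivrMr// ler_pM2l// lerDl.
have := dP _ ty; rewrite normrZ (gtr0_norm t0) => h.
apply: le_trans
  (lerD (norm_derivative_le _ _ t0) (norm_derivative_le _ _ t0)) _.
rewrite /norm_quotient -mulrDl ler_pdivrMr// scalerN; lra.
Qed.

Lemma norm_derivative_linear x : x != 0 ->
  linear (norm_derivative x : X -> R^o).
Proof.
move=> x0.
have D y z : norm_derivative x (y + z) =
    norm_derivative x y + norm_derivative x z.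
  apply/eqP; rewrite eq_le norm_derivativeD/=.
  have := norm_derivativeD x (y + z) (- z).
  by rewrite addrK (norm_derivativeN _ x0) lerBrDr.
move=> a y z; rewrite D; congr (_ + _).
have [a0|a0|<-] := ltgtP 0 a.
- exact: norm_derivativeZ.
- rewrite -[a]opprK scaleNr (norm_derivativeN _ x0).
  rewrite norm_derivativeZ ?oppr_gt0//.
  by rewrite scaleNr.
- by rewrite !scale0r norm_derivative0.
Qed.

(** For [x != 0] the functional is [|x|] times the derivative of the norm, which has dual norm 1 and
    takes the value [|x|] at [x]. *)
Lemma duality_map_exists x :
  exists f : topdual X, f x = `|x| ^+ 2 /\ `|x| ^+ 2 = `|f| ^+ 2.
Proof.
have [->|x0] := eqVneq x 0.
  by exists 0; rewrite linear0 !normr0 expr0n.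
pose L : {linear X -> R^o} := HB.pack (norm_derivative x : X -> R^o)
  (GRing.isLinear.Build R X R^o _ _ (norm_derivative_linear x0)).
have cL : continuous L.
  apply: bounded_linear_continuous; apply/bounded_funP => r; exists r => y.
  exact/le_trans/norm_derivative_norm.
have Lp : norm_derivative x \in @linear_continuous_pred R X.
  by apply/asboolP; split; [exact: norm_derivative_linear|exact: cL].
pose g := TopDual Lp.
have gx : g x = `|x| by exact: norm_derivative_self.
have g1 : `|g| = 1.
  apply/eqP; rewrite eq_le; apply/andP; split.
    by apply: topdual_norm_bound => // v; rewrite mul1r norm_derivative_norm.
  by have := topdual_le g x; rewrite gx ler_pMl// normr_gt0.
exists (`|x| *: g); split; last by rewrite normrZ g1 mulr1 normr_id.
by rewrite expr2 -[X in _ * X]gx.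
Qed.

End DirectionalDerivativeOfNorm.

Section DualityMap.
Variables (R : realType) (X : normedModType R).
Hypothesis hsmooth : uniformly_smooth X.
Implicit Types (x h : X).

Lemma duality_map_self x : duality_map x x = `|x| ^+ 2.
Proof. by have [] := xgetPex 0 (duality_map_exists hsmooth x). Qed.

Lemma duality_map_norm x : `|duality_map x| = `|x|.
Proof.
have [_ /eqP] := xgetPex 0 (duality_map_exists hsmooth x).
by rewrite eqrXn2// => /eqP <-.
Qed.

(** The lower bound is the subgradient inequality coming from [J x (x + h) <= |x| |x + h|]. Applied
    at [- h] and combined with smoothness, it also gives the upper bound. *)
Lemma norm_frechet x (e : R) : x != 0 -> 0 < e ->
  exists2 d : R, 0 < d & forall h, `|h| < d ->
    `| `|x + h| - `|x| - duality_map x h / `|x| | <= e * `|h|.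
Proof.
move=> x0 e0; have nx : 0 < `|x| by rewrite normr_gt0.
have [d d0 dP] := norm_smooth hsmooth x0 e0.
have lb h : `|x| + duality_map x h / `|x| <= `|x + h|.
  have := topdual_le (duality_map x) (x + h).
  rewrite linearD /= duality_map_self duality_map_norm -(ler_pdivrMl _ _ nx).
  rewrite mulrDr expr2 mulrA mulVf ?gt_eqF// mul1r mulrC => h1.
  by rewrite mulrC (mulrC _^-1) in h1 *.
exists d => // h /ltW /dP.
have := lb h; have := lb (- h); rewrite linearN mulNr ler_norml /=.
move: (duality_map x h / `|x|) => j h1 h2 h3; lra.
Qed.

End DualityMap.

(** * The projection onto a ball *)

Section ProjectionOntoBall.
Variables (R : realType) (X : normedModType R).
Hypothesis hconvex : uniformly_convex X.
Implicit Types (x y u v h : X) (r : R).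

Lemma mem_closed_ball0 r x : 0 < r -> closed_ball (0 : X) r x <-> `|x| <= r.
Proof. by move=> r0; rewrite closed_ballE// /closed_ball_/= sub0r normrN. Qed.

Lemma uniformly_convex_strict x y :
  `|x| = 1 -> `|y| = 1 -> 2 <= `|x + y| -> x = y.
Proof.
(* If [x != y], the modulus of convexity at [|x - y|] forces [|x + y| < 2]. *)
move=> x1 y1 xy; apply/eqP; rewrite -subr_eq0 -normr_le0 leNgt.
apply/negP => d0; have [d d1] := hconvex d0.
move=> /(_ x y x1 y1 (lexx _)); rewrite normrZ gtr0_norm; lra.
Qed.

(** With [|x| <= |y|], the sum [x + y] is [|x|] times the sum of the two unit vectors plus
    [|y| - |x|] times the second one. Equality of norms then forces the unit vectors to have a sum
    of norm at least 2. *)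
Lemma eq_norm_add_collinear x y : x != 0 -> y != 0 ->
  `|x + y| = `|x| + `|y| -> `|x|^-1 *: x = `|y|^-1 *: y.
Proof.
wlog xy : x y / `|x| <= `|y|.
  move=> H x0 y0 e; have [xy|/ltW yx] := leP `|x| `|y|; first exact: H.
  by apply/esym/H => //; rewrite addrC e addrC.
rewrite -!normr_gt0 => x0 y0 e.
have x1 : `| `|x|^-1 *: x | = 1.
  by rewrite normrZ normfV normr_id mulVf ?gt_eqF.
have y1 : `| `|y|^-1 *: y | = 1.
  by rewrite normrZ normfV normr_id mulVf ?gt_eqF.
apply: uniformly_convex_strict => //.
have := ler_normD (`|x| *: (`|x|^-1 *: x + `|y|^-1 *: y))
  ((`|y| - `|x|) *: (`|y|^-1 *: y)).
rewrite (normrZ `|x|) normr_id (normrZ (`|y| - _)) y1 mulr1.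
rewrite ger0_norm ?subr_ge0//.
rewrite scalerDr -addrA -scalerDl subrKC !scalerA.
rewrite !divff ?gt_eqF// !scale1r e => h.
by rewrite -(ler_pM2l x0); lra.
Qed.

Lemma ball_projection_in r x : 0 < r -> `|x| <= r ->
  metric_projection (closed_ball 0 r) x = x.
Proof.
move=> r0 xr; apply: xget_unique.
  by split=> [|z _]; [exact/mem_closed_ball0|rewrite subrr normr0].
move=> y [_ /(_ x)]; rewrite subrr normr0 normr_le0 subr_eq0.
by rewrite mem_closed_ball0// => /(_ xr)/eqP.
Qed.

(** A nearest point [p] satisfies [|p| = r] and [|u - p| = |u| - r], so [u = p + (u - p)] is an
    equality case of the triangle inequality and [u] is a multiple of [p]. The case [|u| = r] is
    separate because [u - p] then has no direction. *)
Lemma ball_projection_out r u : 0 < r -> r <= `|u| ->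
  metric_projection (closed_ball 0 r) u = (r / `|u|) *: u.
Proof.
move=> r0; rewrite le_eqVlt => /predU1P[ru|ru].
  by rewrite ball_projection_in -?ru// divff ?gt_eqF// scale1r.
have u0 : 0 < `|u| by exact: lt_trans ru.
have pr : `|(r / `|u|) *: u| = r.
  by rewrite normrZ gtr0_norm ?divr_gt0// divfK ?gt_eqF.
have up : `|u - (r / `|u|) *: u| = `|u| - r.
  rewrite -[X in X - _]scale1r -scalerBl normrZ ger0_norm.
    by rewrite mulrBl mul1r divfK ?gt_eqF.
  by rewrite subr_ge0 ler_pdivrMr// mul1r ltW.
apply: xget_unique.
  split=> [|z]; first by apply/mem_closed_ball0; rewrite ?pr.
  rewrite mem_closed_ball0// up => zr.
  by have := lerB_dist u z; lra.
move=> p [] /mem_closed_ball0 => /(_ r0) pr' /(_ ((r / `|u|) *: u)).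
rewrite mem_closed_ball0// pr lexx up => /(_ erefl) h.
have h2 := ler_normD p (u - p); rewrite subrKC in h2.
have np : `|p| = r by lra.
have nup : `|u - p| = `|u| - r by lra.
have := @eq_norm_add_collinear p (u - p).
rewrite -!normr_gt0 np nup subrKC subr_gt0 => /(_ r0 ru).
rewrite (addrC r) subrK => /(_ erefl) e.
have ur : `|u| - r != 0 by rewrite gt_eqF// subr_gt0.
have : (`|u| - r) *: (r^-1 *: p) = u - p by rewrite e scalerA divff// scale1r.
rewrite scalerA => /(congr1 (+%R p)).
rewrite subrKC -[X in X + _]scale1r -scalerDl => {}e.
rewrite -[X in _ *: X]e scalerA.
have -> : r / `|u| * (1 + (`|u| - r) / r) = 1 by field; rewrite !gt_eqF.
by rewrite scale1r.
Qed.

Lemma ball_projection_lipschitz r u v : 0 < r ->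
  `|metric_projection (closed_ball 0 r) u
    - metric_projection (closed_ball 0 r) v| <= 2 * `|u - v|.
Proof.
move=> r0.
have inout x y : `|x| <= r -> r <= `|y| ->
    `|x - (r / `|y|) *: y| <= 2 * `|x - y|.
  move=> xr ry; have y0 : 0 < `|y| by exact: lt_le_trans ry.
  have -> : x - (r / `|y|) *: y = (x - y) + (y - (r / `|y|) *: y).
    by rewrite addrA subrK.
  apply: le_trans (ler_normD _ _) _.
  have -> : `|y - (r / `|y|) *: y| = `|y| - r.
    rewrite -[X in X - _]scale1r -scalerBl normrZ ger0_norm.
      by rewrite mulrBl mul1r divfK ?gt_eqF.
    by rewrite subr_ge0 ler_pdivrMr// mul1r.
  by have := lerB_dist y x; rewrite distrC; lra.
have [ur|/ltW ru] := leP `|u| r; have [vr|/ltW rv] := leP `|v| r.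
- by rewrite !ball_projection_in// ler_peMl// ler1n.
- by rewrite ball_projection_in// ball_projection_out// inout.
- rewrite ball_projection_out// ball_projection_in// distrC (distrC u).
  exact: inout.
rewrite !ball_projection_out//.
have u0 : 0 < `|u| by exact: lt_le_trans ru.
have v0 : 0 < `|v| by exact: lt_le_trans rv.
(* The second summand has norm [(r / |u|) | |v| - |u| |], so each summand is at most [|u - v|]. *)
have -> : (r / `|u|) *: u - (r / `|v|) *: v =
    (r / `|u|) *: (u - v) + ((r / `|u|) * ((`|v| - `|u|) / `|v|)) *: v.
  rewrite scalerBr -addrA -2!scaleNr -scalerDl; congr (_ + _ *: _).
  by field; rewrite !gt_eqF.
have c1 : r / `|u| <= 1 by rewrite ler_pdivrMr// mul1r.
have c0 : 0 < r / `|u| by exact: divr_gt0.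
apply: le_trans (ler_normD _ _) _.
rewrite (normrZ (r / _)) (normrZ (_ * _)) (normrM (r / _))
  (normrM (_ - _)) normfV normr_id.
rewrite (gtr0_norm c0) -(mulrA (r / _)) divfK ?gt_eqF// -mulrDr.
have := ler_dist_dist v u; rewrite (distrC v) => h.
have n0 := normr_ge0 (u - v).
have h' : `|u - v| + `| `|v| - `|u| | <= 2 * `|u - v| by lra.
by apply: le_trans h'; rewrite ler_piMl// addr_ge0.
Qed.

End ProjectionOntoBall.

(** * Coderivatives of the projection *)

(* The left-hand side is [r / (n m)] times
   [(m - n) b - (n - m - j / m) a + a (n - m) j / m^2]. *)
Lemma radial_remainder_bound (R : realType) (r m n a b j N K e e1 : R) :
  0 <= e -> 0 < r -> 0 < m -> m / 2 <= n -> 0 <= N -> 0 <= K ->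
  `|a| <= K * m -> `|b| <= K * N -> `|j| <= m * N -> `|n - m| <= N ->
  `|n - m - j / m| <= e1 * N -> N <= e1 * m / 2 -> 4 * r * K * e1 <= e * m ->
  `|r / n * (a + b) - r / m * a - r / m * (b - a / m ^+ 2 * j)| <= e * N.
Proof.
move=> e0 r0 m0 mn N0 K0 am bN jm nm dN Ne Ke.
have n0 : 0 < n by lra.
pose B := (m - n) * b - (n - m - j / m) * a + a / m * (n - m) * (j / m).
have -> : r / n * (a + b) - r / m * a - r / m * (b - a / m ^+ 2 * j) =
  r / (n * m) * B by rewrite /B; field; rewrite !gt_eqF.
have am' : `|a / m| <= K by rewrite normrM normfV (gtr0_norm m0) ler_pdivrMr.
have jm' : `|j / m| <= N.
  by rewrite normrM normfV (gtr0_norm m0) ler_pdivrMr// mulrC.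
(* The three terms of [B] are at most [K N^2], [e1 K m N] and [K N^2]; since [N <= e1 m / 2], each
   [K N^2] is at most half of [e1 K m N]. *)
have BN : `|B| <= 2 * e1 * m * K * N.
  apply: (@le_trans _ _ (N * (K * N) + e1 * N * (K * m) + K * N * N));
      last first.
    have : K * N * N <= K * N * (e1 * m / 2) by rewrite ler_wpM2l// mulr_ge0.
    by move=> h; lra.
  apply: le_trans (ler_normD _ _) _; apply: lerD.
    apply: le_trans (ler_normB _ _) _; rewrite !normrM; apply: lerD.
      by apply: ler_pM => //; rewrite distrC.
    exact: ler_pM.
  rewrite (normrM (_ * (n - m))) (normrM (a / m)).
  by apply: ler_pM => //; exact: ler_pM.
rewrite normrM gtr0_norm ?divr_gt0 ?mulr_gt0// mulrAC ler_pdivrMr ?mulr_gt0//.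
apply: (@le_trans _ _ (r * (2 * e1 * m * K * N))); first by rewrite ler_pM2l.
(* From [m / 2 <= n] the prefactor [r / (n m)] is at most [2 r / m^2]. *)
have h1 : 4 * r * K * e1 * (m * N) <= e * m * (m * N).
  by rewrite ler_wpM2r// mulr_ge0// ltW.
have h2 : e * N * (m / 2 * m) <= e * N * (n * m).
  by rewrite ler_wpM2l ?mulr_ge0// ler_wpM2r// ltW.
lra.
Qed.

Section CoderivativeOfBallProjection.
Variables (R : realType) (X : normedModType R).
Hypothesis hsmooth : uniformly_smooth X.
Hypothesis hconvex : uniformly_convex X.
Implicit Types (x h v : X) (r : R) (ys : topdual X).

Lemma ostarE x ys h :
  ostar x ys h = ys h - ys x / `|x| ^+ 2 * duality_map x h :> R.
Proof. by []. Qed.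

(** The restriction [r <= |x + h|] makes the expansion valid at sphere points too, along
    displacements that do not enter the open ball. *)
Lemma ball_projection_frechet r x ys (e : R) : 0 < r -> r <= `|x| -> 0 < e ->
  exists2 d : R, 0 < d & forall h, `|h| < d -> r <= `|x + h| ->
    `|ys (metric_projection (closed_ball 0 r) (x + h)
          - metric_projection (closed_ball 0 r) x)
      - (r / `|x|) * ostar x ys h| <= e * `|h|.
Proof.
move=> r0 rx e0; have m0 : 0 < `|x| by exact: lt_le_trans rx.
have x0 : x != 0 by rewrite -normr_gt0.
(* Chosen so that [4 r |ys| e1 <= e |x|]; the added 1 covers [ys = 0]. *)
pose e1 := e * `|x| / (4 * r * (`|ys| + 1)).
have K1 : 0 < 4 * r * (`|ys| + 1) by rewrite !mulr_gt0// ltr_wpDl.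
have e10 : 0 < e1 by rewrite divr_gt0 ?mulr_gt0.
have [d d0 dP] := norm_frechet hsmooth x0 e10.
exists (Num.min d (Num.min (`|x| / 2) (e1 * `|x| / 2))).
  rewrite !lt_min d0 /=.
  by apply/andP; split; apply: divr_gt0 => //; exact: mulr_gt0.
move=> h; rewrite !lt_min => /and3P[/dP dh hm he] rxh.
have nm : `| `|x + h| - `|x| | <= `|h|.
  by have := ler_dist_dist (x + h) x; rewrite [x + h - x]addrC addKr.
rewrite !ball_projection_out// ostarE.
rewrite [ys (_ - _)]linearB /= !topdualZ [ys (_ + _)]linearD.
(* Here [m = |x|], [n = |x + h|], [a = ys x], [b = ys h], [j = J x h], [N = |h|] and [K = |ys|]. *)
apply: (@radial_remainder_bound _ _ _ _ _ _ _ _ `|ys| _ e1) => //.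
- exact: ltW.
- by move: nm; rewrite ler_norml; lra.
- exact: topdual_norm_le.
- exact: topdual_norm_le.
- by rewrite -(duality_map_norm hsmooth x); exact: topdual_norm_le.
- exact: ltW.
rewrite /e1 mulrA ler_pdivrMr// -subr_ge0.
have -> : e * `|x| * (4 * r * (`|ys| + 1)) - 4 * r * `|ys| * (e * `|x|) =
  4 * r * (e * `|x|) by ring.
by rewrite !mulr_ge0 ?ltW.
Qed.

Let D r := mordukhovich_derivative (metric_projection (closed_ball (0 : X) r)).

Lemma ball_projection_increment r x h : 0 < r ->
  `|metric_projection (closed_ball 0 r) (x + h)
    - metric_projection (closed_ball 0 r) x| <= 2 * `|h|.
Proof.
move=> r0; apply: le_trans (ball_projection_lipschitz hconvex _ _ r0) _.
by rewrite [x + h]addrC addrK.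
Qed.

Lemma coderivative_interior r x ys : `|x| < r -> D r x ys = [set ys].
Proof.
move=> xr; have r0 : 0 < r by exact: le_lt_trans xr.
apply: coderivative_singleton => [h|e e0].
  exact: ball_projection_increment.
exists (r - `|x|) => [|h hr]; first by rewrite subr_gt0.
rewrite !ball_projection_in ?(ltW xr)//; last first.
  by apply: le_trans (ler_normD _ _) _; lra.
by rewrite (addrC x) addrK subrr normr0 mulr_ge0// ltW.
Qed.

Lemma coderivative_exterior r x ys : 0 < r -> r < `|x| ->
  D r x ys = [set (r / `|x|) *: ostar x ys].
Proof.
move=> r0 rx; apply: coderivative_singleton => [h|e e0].
  exact: ball_projection_increment.
have [d d0 dP] := ball_projection_frechet ys r0 (ltW rx) e0.
exists (Num.min d (`|x| - r)) => [|h]; first by rewrite lt_min d0 subr_gt0.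
rewrite lt_min => /andP[/dP dh hr]; apply: dh.
by have := lerB_normD x h; lra.
Qed.

(** The zero functional composed with the projection is constant, so the singleton criterion applies
    even on the sphere. *)
Lemma coderivative_zero r x : 0 < r -> D r x 0 = [set 0].
Proof.
move=> r0; apply: coderivative_singleton => [h|e e0].
  exact: ball_projection_increment.
by exists 1 => // h _; rewrite subrr normr0 mulr_ge0// ltW.
Qed.

(** On the ball [J x] is maximal at [x], so the left-hand side of the inequality is nonpositive for
    every [h] and any radius works. *)
Lemma coderivative_zero_neg_duality_map r x (c : R) : 0 <= c -> `|x| = r ->
  0 < r -> D r x (- c *: duality_map x) 0.
Proof.
move=> c0 xr r0; apply/mordukhovich_zeroP => e e0; exists 1 => // h _.
rewrite [X in X <= _](_ : _ = c * (duality_map x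
  (metric_projection (closed_ball 0 r) (x + h))
  - duality_map x (metric_projection (closed_ball 0 r) x))).
  apply: (@le_trans _ _ 0); last by rewrite mulr_ge0 ?addr_ge0// ltW.
  rewrite mulr_ge0_le0// subr_le0 (ball_projection_in r0 (x := x)) ?xr//.
  rewrite duality_map_self// (le_trans (topdual_le _ _))//.
  rewrite duality_map_norm// expr2 ler_wpM2l//.
  have [xhr|/ltW xhr] := leP `|x + h| r.
    by rewrite ball_projection_in// xr.
  rewrite ball_projection_out// normrZ gtr0_norm.
    by rewrite divfK ?xr// gt_eqF// (lt_le_trans r0).
  by rewrite divr_gt0// (lt_le_trans r0).
by rewrite -linearB -[LHS]mulNr opprK.
Qed.

Lemma coderivative_duality_map_sphere r x : 0 < r -> `|x| = r ->
  D r x (duality_map x) = set0.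
Proof.
move=> r0 xr; apply/seteqP; split => // xs /mordukhovichP Dxs.
(* Along [t x] the projection stays put, giving [xs x <= e r]; along [- t x] it is the identity,
   giving [r^2 - xs x <= 2 e r]. Together [r^2 <= 3 e r], which fails for [e = r / 6]. *)
have e0 : 0 < r / 6 by rewrite divr_gt0.
have [d d0 dP] := Dxs _ e0.
have d1 : 0 < Num.min d 1 by rewrite lt_min d0 ltr01.
have [t /andP[t0]] := exists_small_scaling x d1.
rewrite !lt_min => /andP[_ t1] /andP[td _].
have tx : `|t *: x| = t * r by rewrite normrZ gtr0_norm// xr.
have x1 : x + t *: x = (1 + t) *: x by rewrite scalerDl scale1r.
have x2 : x - t *: x = (1 - t) *: x by rewrite scalerBl scale1r.
have := dP _ td; have := dP (- (t *: x)); rewrite normrN => /(_ td).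
rewrite tx x1 x2 (ball_projection_in r0 (x := x)) ?xr//.
have xt2 : `|(1 - t) *: x| <= r.
  by rewrite normrZ ger0_norm ?xr ?ler_piMl ?ltW//; lra.
have xt1 : `|(1 + t) *: x| = (1 + t) * r.
  by rewrite normrZ gtr0_norm ?xr//; lra.
rewrite ball_projection_in// ball_projection_out//; last first.
  by rewrite xt1 ler_peMl// ?ltW//; lra.
rewrite xt1 scalerA -x2 (addrC x (- _)) addrK normrN tx.
have -> : r / ((1 + t) * r) * (1 + t) = 1 by field; rewrite !gt_eqF//; lra.
rewrite scale1r subrr !linear0 normr0 !addr0 !linearN !linearZ /=.
rewrite /GRing.scale /= duality_map_self// xr.
move: (xs x : R) => a h1 h2.
have r20 : 0 < r ^+ 2 by exact: exprn_gt0.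
have h3 : r ^+ 2 <= r ^+ 2 / 2 by rewrite -(ler_pM2l t0); lra.
lra.
Qed.

(** * Necessary conditions for a zero coderivative element at a sphere point *)

Section ZeroCoderivativeOnSphere.
Variables (r : R) (x : X) (ys : topdual X).
Hypotheses (r0 : 0 < r) (xr : `|x| = r) (Dys : D r x ys 0).
Let w := dual_duality_map (ostar x ys).

(* Also true with the default value [w = 0] of [xget]. *)
Let ostar_w : ostar x ys w = `|w| ^+ 2 :> R.
Proof.
rewrite /w /dual_duality_map; case: xgetP => [z _ [-> ->]//|_].
by rewrite linear0 normr0 expr0n.
Qed.

(* Inside the ball the projection is the identity, so [v] is a direction along
   which the coderivative inequality can be divided by [t |v|]. *)
Lemma coderivative_zero_le0 v :
  (forall d, 0 < d -> exists2 t, 0 < t < d & `|x + t *: v| <= r) ->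
  0 <= ys v :> R.
Proof.
move=> xv; rewrite -oppr_le0.
apply: (@le0_of_le_eps_mul _ _ (2 * `|v|)); first exact: mulr_ge0.
move=> e e0; have /mordukhovich_zeroP/(_ e e0)[d d0 dP] := Dys.
have v1 : 0 < `|v| + 1 by rewrite ltr_wpDl.
have [t /andP[t0 td] xt] := xv (d / (`|v| + 1)) (divr_gt0 d0 v1).
have tv : `|t *: v| = t * `|v| by rewrite normrZ gtr0_norm.
have tvd : `|t *: v| < d.
  rewrite tv; move: td; rewrite ltr_pdivlMr//; lra.
have := dP _ tvd; rewrite !ball_projection_in ?xr// (addrC x) addrK tv.
rewrite linearZ /= /GRing.scale /= => h; rewrite -(ler_pM2l t0); lra.
Qed.

(** The direction [- x] points into the ball. *)
Lemma coderivative_zero_base_le0 : ys x <= 0 :> R.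
Proof.
rewrite -oppr_ge0 -linearN; apply: coderivative_zero_le0 => d d0.
have d1 : 0 < Num.min d 1 by rewrite lt_min d0 ltr01.
have [t /andP[t0]] := exists_small_scaling x d1.
rewrite !lt_min => /andP[td t1] _; exists t; first by rewrite t0.
rewrite scalerN -[X in X - _]scale1r -scalerBl normrZ ger0_norm ?xr; last lra.
by rewrite ler_piMl ?ltW//; lra.
Qed.

(** If [- w] left the ball, [ys] of the increment along [- t w] would be close to
    [ostar x ys (- t w) = - t |w|^2], too negative for the coderivative inequality. *)
Lemma coderivative_zero_not_up : ~ up_directions r x (- w).
Proof.
move=> [w0 [d' d'0 d'P]].
have nw : 0 < `|w|.
  by rewrite normr_gt0; apply/eqP => w00; apply: w0; rewrite w00 oppr0.
clear w0.
(* The expansion costs [e t |w|] and the coderivative inequality at most [3 e t |w|], in total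
   [t |w|^2 / 2]. *)
have e0 : 0 < `|w| / 8 by rewrite divr_gt0.
have /mordukhovich_zeroP/(_ _ e0)[d1 d10 d1P] := Dys.
have rx : r <= `|x| by rewrite xr.
have [d2 d20 d2P] := ball_projection_frechet ys r0 rx e0.
have d0 : 0 < Num.min d' (Num.min d1 d2) by rewrite !lt_min d'0 d10.
have [t /andP[t0]] := exists_small_scaling (- w) d0.
rewrite !lt_min => /and3P[td' _ _] /and3P[_ td1 td2].
have tw : `|t *: - w| = t * `|w| by rewrite normrZ gtr0_norm// normrN.
have up : r < `|x + t *: - w| by apply: d'P; rewrite t0.
have := d2P _ td2 (ltW up); have := d1P _ td1.
have := ball_projection_increment x (t *: - w) r0.
rewrite xr divff ?gt_eqF// mul1r tw.
have -> : ostar x ys (t *: - w) = - (t * `|w| ^+ 2).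
  by rewrite scalerN -scaleNr topdualZ ostar_w mulNr.
move: (ys _ : R) (`|_ - _|) => a N h1 h2; rewrite ler_norml => /andP[_ h3].
have h4 : `|w| / 8 * N <= `|w| / 8 * (2 * (t * `|w|)) by rewrite ler_pM2l.
have h5 : 0 < t * `|w| ^+ 2 by rewrite mulr_gt0// exprn_gt0.
lra.
Qed.

(** The left-hand side equals [ys w]. As [- w] is not an up direction, arbitrarily small steps along
    it end in the ball, hence [ys (- w) >= 0]. *)
Lemma coderivative_zero_dual_le0 :
  ys x / r ^+ 2 * duality_map x w + `|w| ^+ 2 <= 0 :> R.
Proof.
rewrite -ostar_w ostarE xr subrKC.
have [->|w0] := eqVneq w 0; first by rewrite linear0.
rewrite -oppr_ge0 -linearN; apply: coderivative_zero_le0 => d d0.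
apply: contrapT => nt; apply: coderivative_zero_not_up; split.
  by apply/eqP; rewrite oppr_eq0.
exists d => // t td; rewrite ltNge; apply/negP => xt.
by apply: nt; exists t.
Qed.

End ZeroCoderivativeOnSphere.

End CoderivativeOfBallProjection.
Theorem theorem3p1 (R : realType) (X : completeNormedModType R)
    (hconvex : uniformly_convex X) (hsmooth : uniformly_smooth X)
    (r : R) (hr : 0 < r) :
  let rB := closed_ball (0 : X) r in
  let rS := [set x : X | `|x| = r] in
  let J := @duality_map R X in
  let Js := @dual_duality_map R X in
  let D := mordukhovich_derivative (metric_projection rB) in
  [/\
    (* (i) *)
    forall xb : X, rB° xb -> forall ys : topdual X, D xb ys = [set ys],
    (* (ii) *)
    forall xb : X, ~ rB xb ->
      [/\ forall ys : topdual X,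
            D xb ys =
            [set (r / `|xb|) *: (ys - (ys xb / `|xb| ^+ 2) *: J xb)],
          forall ys : topdual X, ys xb = 0 ->
            D xb ys = [set (r / `|xb|) *: ys]
        & D xb (J xb) = [set 0]]
  & (* (iii) *)
    forall xb : X, rS xb ->
      [/\ (* (a) *)
          D xb 0 = [set 0],
          (* (b), part 1 *)
          forall ys : topdual X, ys <> 0 -> D xb ys 0 ->
            [/\ ys xb <= 0,
                ~ up_directions r xb (- Js (ostar xb ys))
              & ys xb / r ^+ 2 * J xb (Js (ostar xb ys))
                  + `|Js (ostar xb ys)| ^+ 2 <= 0],
          (* (b), part 2 *)
          (forall ys : topdual X, ys <> 0 -> ostar xb ys = 0 -> ys xb < 0 ->
             D xb ys 0) /\
          D xb (- J xb) 0
        & (* (c) *)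
          D xb (J xb) = set0]].
Proof.
move=> rB rS J Js D.
split.
- move=> x; rewrite /rB interior_closed_ballE// -ball_normE /= sub0r normrN.
  by move=> xr ys; exact: coderivative_interior.
- move=> x; rewrite /rB (mem_closed_ball0 _ hr) => /negP; rewrite -ltNge => rx.
  have Dx := coderivative_exterior hsmooth hconvex _ hr rx.
  split=> // [ys ysx|].
    by rewrite /D Dx /ostar ysx mul0r scale0r subr0.
  rewrite /D Dx /ostar (duality_map_self hsmooth) divff.
    by rewrite scale1r subrr scaler0.
  by rewrite sqrf_eq0 gt_eqF// (lt_trans hr).
move=> x xr; have {}xr : `|x| = r := xr.
have DJ := coderivative_zero_neg_duality_map hsmooth hconvex _ xr hr.
split.
- exact: coderivative_zero.
- move=> ys _ Dys; split.
  + exact: coderivative_zero_base_le0 Dys.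
  + exact: coderivative_zero_not_up Dys.
  + exact: coderivative_zero_dual_le0 Dys.
- split=> [ys _ /eqP + ysx|]; last by have := DJ 1 ler01; rewrite scaleN1r.
  (* Vanishing of [ostar] means [ys = (ys x / |x|^2) J x], so [c = - ys x / |x|^2] is
     nonnegative. *)
  rewrite subr_eq0 => /eqP ->; rewrite -[_ / _]opprK; apply: DJ.
  by rewrite -mulNr divr_ge0 ?oppr_ge0 ?sqr_ge0// ltW.
exact: coderivative_duality_map_sphere.
Qed.
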